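(* Let $0<\epsilon\le1$ and let $w$ be a probability distribution on $\mathbb{N}_0$ with $w(0)=1-\epsilon$. Let $Z_1,Z_2,\dots$ be i.i.d. with $\mathbb{P}(Z_j=k)=w(k)$, $J_0=0$, $J_n=\sum_{j=1}^nZ_j$, and let $\Phi^{(n)}(t)=\mathbb{P}(J_n\le t<J_{n+1})$, $n,t\in\mathbb{N}_0$, be the probability of exactly $n$ arrivals within $[0,t]$. Then $$\Phi^{(n)}(0)=\epsilon(1-\epsilon)^n,\qquad n\in\mathbb{N}_0 .$$ Let moreover $\mathbf{H}$ be the one-step transition matrix of the random walk on a finite connected non-bipartite undirected graph with nodes $1,\dots,N$, with spectral representation $\mathbf{H}=|v_1\rangle\langle\bar v_1|+\sum_{m=2}^{N}\lambda_m|v_m\rangle\langle\bar v_m|$, and let $\mathbf{P}(t)=\sum_{n=0}^{\infty}\Phi^{(n)}(t)\mathbf{H}^n$ be the transition matrix of the associated discrete-time random walk. Then $$\mathbf{P}(0)=|v_1\rangle\langle\bar v_1|+(1-w(0))\sum_{m=2}^{N}\frac{|v_m\rangle\langle\bar v_m|}{1-\lambda_mw(0)} .$$ In particular, $\mathbf{P}(0)\to|v_1\rangle\langle\bar v_1|$ as $\epsilon\to0$, and $\mathbf{P}(0)=\mathbf{1}$ for $\epsilon=1$.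
   Context: $\mathbb{N}_0=\{0,1,2,\dots\}$. The graph has symmetric adjacency matrix $A_{ij}\in\{0,1\}$ with $A_{ii}=0$, node degrees $K_i=\sum_jA_{ij}$, and $H_{ij}=A_{ij}/K_i$. $|v_m\rangle$ and $\langle\bar v_m|$ are right and left eigenvectors of $\mathbf{H}$ for $\lambda_m$ ($\lambda_1=1$, $|\lambda_m|<1$ for $m\ge2$), normalized by $\langle\bar v_n|v_m\rangle=\delta_{mn}$, with $\sum_m|v_m\rangle\langle\bar v_m|=\mathbf{1}$; $|a\rangle\langle b|$ is the rank-one matrix (column times row). *)

(* Defs.v *)
From HB Require Import structures.
From mathcomp Require Import all_boot all_order all_algebra.
From mathcomp Require Import all_classical all_reals all_analysis.
From mathcomp Require Export complex.
Set Implicit Arguments.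
Unset Strict Implicit.
Unset Printing Implicit Defensive.
Import Order.TTheory GRing.Theory Num.Theory.
Import numFieldNormedType.Exports.
Local Open Scope classical_set_scope.
Local Open Scope ring_scope.
Local Open Scope complex_scope.

Section Probability.
Context {R : realType}.

Definition prob_distribution (w : nat -> R) : Prop :=
  (forall k, 0 <= w k) /\ series w @ \oo --> (1 : R).

Context {d : measure_display} {T : measurableType d} {P : probability T R}.

Definition mutually_independent (Z : nat -> {RV P >-> nat}) : Prop :=
  forall (I : seq nat) (B : nat -> set nat), uniq I ->
    P (\bigcap_(j in [set` I]) (Z j @^-1` B j)) =
    (\prod_(j <- I) P (Z j @^-1` B j))%E.

Definition iid_with_law (w : nat -> R) (Z : nat -> {RV P >-> nat}) : Prop :=
  mutually_independent Z /\ forall j k, P (Z j @^-1` [set k]) = (w k)%:E.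

(* The sequence is indexed from 0: Z j is the (j+1)-st inter-arrival time,
   so that J_n is the sum of Z 0, ..., Z (n-1). *)
Definition arrival_time (Z : nat -> {RV P >-> nat}) (n : nat) (x : T) : nat :=
  (\sum_(j < n) Z j x)%N.

Definition state_prob (Z : nat -> {RV P >-> nat}) (n t : nat) : R :=
  fine (P [set x | (arrival_time Z n x <= t < arrival_time Z n.+1 x)%N]).

End Probability.

Section Graph.
Variable N : nat.
Implicit Type e : rel 'I_N.

Definition simple_graph e : Prop := symmetric e /\ irreflexive e.

Definition connected_graph e : Prop := forall i j, connect e i j.

Definition bipartite e : Prop :=
  exists c : 'I_N -> bool, forall i j, e i j -> c i != c j.

Definition adjacency (R : realType) e : 'M[R]_N := \matrix_(i, j) (e i j)%:R.

Definition degree (R : realType) e (i : 'I_N) : R :=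
  \sum_j adjacency R e i j.

Definition one_step (R : realType) e : 'M[R]_N :=
  \matrix_(i, j) (adjacency R e i j / degree R e i).

End Graph.

(* R[i]^o is R[i] with its topology as a normed space over itself. *)
Definition complexify (R : realType) (m n : nat) (M : 'M[R]_(m, n)) :
  'M[R[i]^o]_(m, n) := map_mx (real_complex R) M.

Definition ketbra (R : realType) (N : nat) (a : 'cV[R[i]]_N) (b : 'rV[R[i]]_N) :
  'M[R[i]^o]_N := a *m b.

(* The eigenvalue 1 carries the index ord0; eigenvalues and eigenvectors are
   allowed to be complex. *)
Definition spectral_data (R : realType) (N : nat) (H : 'M[R]_N.+1)
    (lambda : 'I_N.+1 -> R[i])
    (v : 'I_N.+1 -> 'cV[R[i]]_N.+1) (vbar : 'I_N.+1 -> 'rV[R[i]]_N.+1) : Prop :=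
  [/\ forall m, (complexify H : 'M[R[i]]_N.+1) *m v m = lambda m *: v m
        /\ vbar m *m (complexify H : 'M[R[i]]_N.+1) = lambda m *: vbar m,
      forall m n, vbar n *m v m = (m == n)%:R%:M,
      \sum_m ketbra (v m) (vbar m) = 1%:M,
      lambda ord0 = 1 /\ (forall m, m != ord0 -> `|lambda m| < 1) &
      complexify H = ketbra (v ord0) (vbar ord0) +
        \sum_(m | m != ord0) lambda m *: ketbra (v m) (vbar m)].

Section Walk.
Context {R : realType} {d : measure_display} {T : measurableType d}.
Context {P : probability T R} {N : nat}.

Definition walk_series (H : 'M[R]_N) (Z : nat -> {RV P >-> nat}) (t : nat) :
    nat -> 'M[R]_N :=
  series (fun n => state_prob Z n t *: H ^+ n).

Definition walk_matrix (H : 'M[R]_N) (Z : nat -> {RV P >-> nat}) (t : nat) :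
    'M[R]_N :=
  limn (walk_series H Z t).

End Walk.

(* Main.v *)
Require Import Defs.
From HB Require Import structures.
From mathcomp Require Import all_boot all_order all_algebra.
From mathcomp Require Import all_classical all_reals all_analysis.
From mathcomp Require Import complex.
Set Implicit Arguments.
Unset Strict Implicit.
Unset Printing Implicit Defensive.
Import Order.TTheory GRing.Theory Num.Theory.
Import numFieldNormedType.Exports.
Local Open Scope classical_set_scope.
Local Open Scope ring_scope.
Local Open Scope complex_scope.

(** At time 0 exactly n arrivals occurred iff the first n waiting times vanish
    and the next one does not, so by independence the state probabilities are
    geometric with ratio q = w(0) = 1 - eps.  So the walk series is the Neumann
    series (1 - q) * sum_n (q H)^n, which sums to (1 - q) (1 - q H)^-1.  On the
    m-th spectral projector the n-th remainder is
    (1 - q) (q lambda_m)^n / (1 - q lambda_m), of modulus at most q^n because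
    |1 - q lambda_m| >= 1 - q; and for m <> 0 the limit is
    eps / (1 - q lambda_m), of modulus at most eps / (1 - |lambda_m|). *)

(** * Functions of a diagonalizable matrix over a field *)

Section SpectralCalculus.
Variables (F : fieldType) (n : nat) (I : finType).
Variables (H : 'M[F]_n.+1) (lambda : I -> F) (K : I -> 'M[F]_n.+1).
Hypothesis sumK : \sum_m K m = 1.
Hypothesis HK : forall m, H * K m = lambda m *: K m.

Lemma expr_spectral k : H ^+ k = \sum_m lambda m ^+ k *: K m.
Proof.
elim: k => [|k IH].
  by rewrite expr0 -sumK; apply: eq_bigr => m _; rewrite expr0 scale1r.
rewrite exprS {}IH mulr_sumr; apply: eq_bigr => m _.
by rewrite -scalerAr HK scalerA -exprSr.
Qed.

(** On the range of [K m] the factor [1 - z *: H] acts as the scalar [1 - lambda m * z], which the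
    coefficient cancels; [sumK] then reassembles the identity. *)
Lemma resolvent_spectral (z : F) : (forall m, 1 - lambda m * z != 0) ->
  (1 - z *: H) * (\sum_m (1 - lambda m * z)^-1 *: K m) = 1.
Proof.
move=> z_neq; rewrite -[RHS]sumK mulr_sumr; apply: eq_bigr => m _.
rewrite -scalerAr mulrBl mul1r -scalerAl HK scalerA.
by rewrite -{1}[K m]scale1r -scalerBl scalerA (mulrC z) mulVf ?scale1r.
Qed.

Lemma geometric_sum_spectral (z : F) k : (forall m, 1 - lambda m * z != 0) ->
  \sum_(j < k) z ^+ j *: H ^+ j =
  \sum_m ((1 - (lambda m * z) ^+ k) / (1 - lambda m * z)) *: K m.
Proof.
move=> z_neq.
under eq_bigr do rewrite expr_spectral scaler_sumr.
rewrite exchange_big; apply: eq_bigr => m _.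
under eq_bigr do rewrite scalerA -exprMn mulrC.
rewrite -scaler_suml; congr (_ *: _).
rewrite -[X in X - _](expr1n _ k) subrXX mulrAC divff ?z_neq // mul1r.
by apply: eq_bigr => j _; rewrite expr1n mul1r.
Qed.

End SpectralCalculus.

(** The norm is a maximum of entry moduli computed among nonnegative elements, where the order is
    total; hence [r] is first lifted to that type. *)
Lemma mx_norm_leP (K : numFieldType) (m n : nat) (M : 'M[K]_(m, n)) (r : K) :
  0 <= r -> reflect (forall i j, `|M i j| <= r) (`|M| <= r).
Proof.
move=> /nonnegP[{}r].
rewrite [X in reflect _ (X <= _)]/Num.Def.normr /= mx_normE num_le.
apply: (iffP idP) => [/bigmax_leP[_ Mr] i j|Mr].
  by have := Mr (i, j) isT; rewrite -num_le.
by apply/bigmax_leP; split=> [|[i j] _]; rewrite -num_le /=.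
Qed.

Lemma norm_complexify (R : realType) (m n : nat) (M : 'M[R]_(m, n)) :
  `|complexify M| = `|M|%:C.
Proof.
have norm_entry i j : `|complexify M i j| = `|M i j|%:C.
  by rewrite mxE normc_def /= expr0n addr0 sqrtr_sqr.
have le1 : `|complexify M| <= `|M|%:C.
  apply/mx_norm_leP => [|i j]; first by rewrite lecR.
  rewrite norm_entry lecR; move: i j; exact/mx_norm_leP.
apply/eqP; rewrite eq_le le1 /=.
(* The norm of a complex matrix is an element of [R[i]]; being real, it equals its real part, so the
   reverse inequality can be checked entrywise in [R]. *)
have re_norm := RRe_real (normr_real (complexify M)).
rewrite -re_norm lecR; apply/mx_norm_leP => [|i j].
  by rewrite -lecR re_norm; exact: normr_ge0.
by rewrite -lecR -norm_entry re_norm; move: i j; apply/mx_norm_leP.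
Qed.

(** Comparable elements of [R[i]] share their imaginary part, so a positive radius in a complex
    normed space is a real one. *)
Lemma gt0_real_complex (R : rcfType) (x : R[i]) : 0 < x ->
  exists2 r : R, 0 < r & x = r%:C.
Proof.
move=> x0; exists (complex.Re x); last by rewrite RRe_real ?gtr0_real.
by rewrite -ltcR RRe_real ?gtr0_real.
Qed.

Lemma ge0_real_complex (R : rcfType) (x : R[i]) : 0 <= x ->
  exists2 r : R, 0 <= r & x = r%:C.
Proof.
move=> x0; exists (complex.Re x); last by rewrite RRe_real ?ger0_real.
by rewrite -lecR RRe_real ?ger0_real.
Qed.

(** * Convergence by domination, for real and for complex norms *)

Section Convergence.
Variables (R : realType) (T : Type) (F : set_system T).
Context {FF : Filter F}.

Lemma cvg_norm_le (V : normedModType R) (f : T -> V) (l : V) (g : T -> R) :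
  (\forall x \near F, `|l - f x| <= g x) -> g x @[x --> F] --> 0 ->
  f x @[x --> F] --> l.
Proof.
move=> fg /cvgrPdist_le g0; apply/cvgrPdist_le => r r0.
have := g0 r r0; apply: filterS2 fg => x fx gx.
by apply: le_trans fx _; apply: le_trans gx; rewrite sub0r normrN ler_norm.
Qed.

Lemma cvg_normc_le (V : normedModType R[i]) (f : T -> V) (l : V) (g : T -> R) :
  (\forall x \near F, `|l - f x| <= (g x)%:C) -> g x @[x --> F] --> 0 ->
  f x @[x --> F] --> l.
Proof.
move=> fg /cvgrPdist_le g0; apply/cvgrPdist_le => _ /gt0_real_complex[r r0 ->].
have := g0 r r0; apply: filterS2 fg => x fx gx.
apply: le_trans fx _; rewrite lecR.
by apply: le_trans gx; rewrite sub0r normrN ler_norm.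
Qed.

End Convergence.

(** * Arrivals at time 0 *)

Section ArrivalTimes.
Context (R : realType) (d : measure_display) (T : measurableType d).
Context (P : probability T R) (Z : nat -> {RV P >-> nat}).

Lemma state_event0 n :
  [set x | (arrival_time Z n x <= 0 < arrival_time Z n.+1 x)%N] =
  \bigcap_(j in [set` iota 0 n.+1])
    (Z j @^-1` (if j == n then ~` [set 0%N] else [set 0%N])).
Proof.
have : forall j, (j \in iota 0 n.+1) = (j <= n)%N.
  by move=> j; rewrite mem_iota add0n ltnS.
(* Only membership in the index list matters; abstracting it keeps simplification from unfolding
   it. *)
move: (iota 0 n.+1) => s sE; apply/seteqP; split=> x /=.
  rewrite /arrival_time leqn0 => /andP[/eqP Jn].
  rewrite big_ord_recr /= Jn add0n => Zn j /=.
  rewrite sE => jn; case: (ltngtP j n) jn => // [jn|->] _ /=.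
    by move/eqP: Jn; rewrite sum_nat_eq0 => /forallP /(_ (Ordinal jn)) /eqP.
  by move=> Zn0; rewrite Zn0 in Zn.
move=> Zx.
have Jn : arrival_time Z n x = 0%N.
  apply: big1 => j _; have := Zx j; rewrite /= sE.
  by rewrite (ltnW (ltn_ord j)) (ltn_eqF (ltn_ord j)); exact.
have := Zx n; rewrite /= sE leqnn eqxx => /(_ isT) /= Zn.
rewrite Jn leqnn /=.
move: Jn; rewrite /arrival_time big_ord_recr /= => ->.
by rewrite add0n lt0n; apply/eqP.
Qed.

(** Independence over the indices [0], ..., [n] gives [n] factors [w 0] and, from the complement
    event at index [n], one factor [1 - w 0]. *)
Lemma state_prob0 (w : nat -> R) n : iid_with_law w Z ->
  state_prob Z n 0 = (1 - w 0%N) * w 0%N ^+ n.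
Proof.
move=> [indep law]; rewrite /state_prob state_event0 indep ?iota_uniq //.
rewrite -[iota 0 n.+1]/(index_iota 0 n.+1) big_nat_recr //= eqxx.
have -> : P (Z n @^-1` (~` [set 0%N])) = (1 - w 0%N)%:E.
  rewrite -preimage_setC probability_setC ?law //.
  exact: measurable_funPTI.
have -> : (\prod_(0 <= j < n) P (Z j @^-1` (if j == n then ~` [set 0%N]
    else [set 0%N])) = (w 0%N ^+ n)%:E)%E.
  rewrite big_nat (eq_bigr (fun=> (w 0%N)%:E)); last first.
    by move=> j /andP[_ jn]; rewrite (ltn_eqF jn) law.
  by rewrite -big_nat prodEFin prodr_const_nat subn0.
by rewrite -EFinM /= mulrC.
Qed.

End ArrivalTimes.

(** * The geometric walk series and its limit in spectral form *)

Section SpectralWalk.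
Variables (R : realType) (N : nat) (H : 'M[R]_N.+1).
Variables (lambda : 'I_N.+1 -> R[i]).
Variables (v : 'I_N.+1 -> 'cV[R[i]]_N.+1) (vbar : 'I_N.+1 -> 'rV[R[i]]_N.+1).
Hypothesis spec : spectral_data H lambda v vbar.

Local Notation K m := (ketbra (v m) (vbar m)).

Let sumK : \sum_m K m = 1.
Proof. by case: spec. Qed.

Let HK m : complexify H * K m = lambda m *: K m.
Proof.
case: spec => eigen _ _ _ _; have [Hv _] := eigen m.
rewrite /ketbra; etransitivity; first exact: mulmxA.
by rewrite Hv; exact: esym (scalemxAl _ _ _).
Qed.

Lemma norm_eigenvalue_le1 m : `|lambda m| <= 1.
Proof.
case: spec => _ _ _ [lambda0 lambda_lt1] _.
by have [->|/lambda_lt1/ltW//] := eqVneq m ord0; rewrite lambda0 normr1.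
Qed.

(** Both bounds weaken the reverse triangle inequality. The first is uniform in [m] and serves the
    convergence of the series at fixed [q]; the second is uniform in [q] and serves the limit
    [q -> 1] for [m != ord0]. *)
Lemma resolvent_denominator_ge (q : R) m : 0 <= q <= 1 ->
  (1 - q)%:C <= `|1 - lambda m * q%:C| /\ 1 - `|lambda m| <= `|1 - lambda m * q%:C|.
Proof.
move=> /andP[q0 q1].
have normq : `|q%:C : R[i]| = q%:C by rewrite ger0_norm // lecR.
have le_norm : 1 - `|lambda m| * q%:C <= `|1 - lambda m * q%:C|.
  by have := lerB_dist 1 (lambda m * q%:C); rewrite normr1 normrM normq.
split; apply: le_trans le_norm.
  rewrite rmorphB rmorph1 lerB // -[leRHS]mul1r ler_wpM2r ?norm_eigenvalue_le1 //.
  by rewrite lecR.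
by rewrite lerB // -[leRHS]mulr1 ler_wpM2l // lecR.
Qed.

Lemma resolvent_denominator_neq0 (q : R) m : 0 <= q < 1 ->
  1 - lambda m * q%:C != 0.
Proof.
move=> /andP[q0 q1]; rewrite -normr_gt0.
have [|ge1q _] := @resolvent_denominator_ge q m; first by rewrite q0 ltW.
by apply: lt_le_trans ge1q; rewrite ltcR subr_gt0.
Qed.

(** Closed form of the Neumann series, kept real. The inverse is total; for [0 <= q < 1] it is a
    genuine one, as the proof of [walk_limit_spectral] shows. *)
Definition walk_limit (q : R) : 'M[R]_N.+1 := (1 - q) *: (1 - q *: H)^-1.

Lemma walk_limit_spectral (q : R) : 0 <= q < 1 ->
  complexify (walk_limit q) =
  \sum_m ((1 - q)%:C / (1 - lambda m * q%:C)) *: K m.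
Proof.
move=> q01.
have inv1 := resolvent_spectral sumK HK (fun m => resolvent_denominator_neq0 m q01).
have cE : 1 - q%:C *: complexify H = complexify (1 - q *: H).
  by rewrite /complexify map_mxB map_mx1 map_mxZ.
rewrite cE in inv1.
(* The explicit right inverse makes the complexified matrix invertible, so it coincides with the
   image of the real inverse. *)
have [u1 _] := mulmx1_unit inv1.
rewrite /complexify /walk_limit map_mxZ map_invmx -/(complexify _).
transitivity ((1 - q)%:C *: \sum_m (1 - lambda m * q%:C)^-1 *: K m).
  congr (_ *: _); rewrite -[LHS]mulr1 -inv1 mulrA.
  by rewrite (mulVmx u1 : _ * _ = 1) mul1r.
by rewrite scaler_sumr; apply: eq_bigr => m _; rewrite scalerA.
Qed.

(** The eigenvalue 1 turns the leading coefficient into [(1 - q) / (1 - q)], that is 1. *)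
Lemma walk_limit_ketbra (q : R) : 0 <= q < 1 ->
  complexify (walk_limit q) = K ord0 +
    (1 - q%:C) *: \sum_(m | m != ord0) (1 - lambda m * q%:C)^-1 *: K m.
Proof.
move=> q01; rewrite walk_limit_spectral // (bigD1 ord0) //=.
case: spec => _ _ _ [lambda0 _] _; rewrite lambda0 mul1r rmorphB rmorph1.
congr (_ + _).
  rewrite divff ?scale1r //.
  by have := resolvent_denominator_neq0 ord0 q01; rewrite lambda0 mul1r.
by rewrite scaler_sumr; apply: eq_bigr => m _; rewrite scalerA.
Qed.

Lemma geometric_walk_spectral (q : R) n : 0 <= q < 1 ->
  complexify (series (fun k => ((1 - q) * q ^+ k) *: H ^+ k) n) =
  \sum_m ((1 - q)%:C * (1 - (lambda m * q%:C) ^+ n) /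
           (1 - lambda m * q%:C)) *: K m.
Proof.
move=> q01.
have := geometric_sum_spectral sumK HK n
  (fun m => resolvent_denominator_neq0 m q01).
rewrite /series /= big_mkord => geomE.
transitivity ((1 - q)%:C *: \sum_(j < n) q%:C ^+ j *: complexify H ^+ j).
  rewrite /complexify map_mx_sum scaler_sumr; apply: eq_bigr => j _.
  by rewrite map_mxZ rmorphM rmorphXn /= [map_mx _ (H ^+ j)]rmorphXn scalerA.
by rewrite geomE scaler_sumr; apply: eq_bigr => m _; rewrite scalerA mulrA.
Qed.

Lemma geometric_walk_cvg (q : R) : 0 <= q < 1 ->
  series (fun n => ((1 - q) * q ^+ n) *: H ^+ n) @ \oo --> walk_limit q.
Proof.
move=> q01; have /andP[q0 q1] := q01.
(* The remainder will be bounded by [C * q ^+ n], with [C] the sum of the norms of the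
   projectors. *)
have [C C0 CE] : exists2 C : R, 0 <= C & \sum_m `|K m| = C%:C.
  by apply: ge0_real_complex; apply: sumr_ge0.
have normq1 : `|q| < 1 by rewrite ger0_norm.
apply: (@cvg_norm_le _ _ _ _ _ _ _ (geometric C q)); last exact: cvg_geometric.
apply: nearW => n; rewrite -lecR -norm_complexify.
have -> : complexify (walk_limit q -
    series (fun k => ((1 - q) * q ^+ k) *: H ^+ k) n) =
  \sum_m ((1 - q)%:C / (1 - lambda m * q%:C) * (lambda m * q%:C) ^+ n) *: K m.
  rewrite /complexify map_mxB -!/(complexify _) walk_limit_spectral //.
  rewrite geometric_walk_spectral // -sumrB; apply: eq_bigr => m _.
  by rewrite -scalerBl [X in _ - X]mulrAC -[X in X - _]mulr1 -mulrBr subKr.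
apply: le_trans (ler_norm_sum _ _ _) _.
rewrite /= rmorphM /= -CE mulr_suml; apply: ler_sum => m _.
have D_neq0 := resolvent_denominator_neq0 m q01.
have [|ge1q _] := @resolvent_denominator_ge q m; first by rewrite q0 ltW.
rewrite normrZ mulrC ler_wpM2l // !normrM normrV ?unitfE //.
rewrite -[leRHS]mul1r ler_pM //.
(* The prefactor has modulus at most 1 by the first denominator bound; what is left is the power,
   bounded using [|lambda m| <= 1]. *)
- by rewrite ler_pdivrMr ?normr_gt0 // mul1r ger0_norm // lecR subr_ge0 ltW.
rewrite normrX rmorphXn /=.
apply: lerXn2r; rewrite ?nnegrE ?normr_ge0 //; first by rewrite lecR.
rewrite normrM (ger0_norm (_ : 0 <= q%:C)) ?lecR //.
by rewrite -[leRHS]mul1r ler_wpM2r ?norm_eigenvalue_le1 // lecR.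
Qed.

Lemma walk_limit_cvg : complexify (walk_limit (1 - eps)) @[eps --> 0^'+] --> K ord0.
Proof.
(* This constant does not depend on [eps]: each [1 / |1 - lambda m * q|] is at most
   [1 / (1 - |lambda m|)], and the common factor [eps] forces convergence. *)
have [C C0 CE] : exists2 C : R, 0 <= C &
    \sum_(m | m != ord0) (1 - `|lambda m|)^-1 * `|K m| = C%:C.
  apply: ge0_real_complex; apply: sumr_ge0 => m _.
  by rewrite mulr_ge0 // invr_ge0 subr_ge0 norm_eigenvalue_le1.
apply: (@cvg_normc_le _ _ _ _ _ _ _ (fun eps => eps * C)); last first.
  rewrite -[X in _ --> X](mul0r C); apply: cvgMl.
  exact: cvg_at_right_filter.
near=> eps.
have eps0 : 0 < eps by [].
have eps1 : eps < 1 by near: eps; exact: nbhs_right_lt.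
have q01 : 0 <= 1 - eps < 1 by rewrite subr_ge0 ltW //= gtrBl.
rewrite distrC walk_limit_ketbra // addrC addKr.
have -> : 1 - (1 - eps)%:C = eps%:C :> R[i] by rewrite rmorphB rmorph1 subKr.
have eps_ge0 : 0 <= eps%:C :> R[i] by rewrite lecR ltW.
rewrite rmorphM /= -CE normrZ ger0_norm // ler_wpM2l //.
apply: le_trans (ler_norm_sum _ _ _) _; apply: ler_sum => m m0.
rewrite normrZ ler_wpM2r // normrV ?unitfE ?resolvent_denominator_neq0 //.
have lambda_lt1 : `|lambda m| < 1 by case: spec => _ _ _ [_ lt1] _; exact: lt1.
have [|_ ge1l] := @resolvent_denominator_ge (1 - eps) m.
  by case/andP: q01 => -> /ltW.
rewrite lef_pV2 // posrE ?subr_gt0 // normr_gt0.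
exact: resolvent_denominator_neq0.
Unshelve. all: by end_near.
Qed.

End SpectralWalk.

(** * From the probabilistic walk to the geometric series *)

Lemma walk_seriesE (R : realType) (N : nat) (H : 'M[R]_N.+1) (w : nat -> R)
    (d : measure_display) (T : measurableType d) (P : probability T R)
    (Z : nat -> {RV P >-> nat}) : iid_with_law w Z ->
  walk_series H Z 0 = series (fun n => ((1 - w 0%N) * w 0%N ^+ n) *: H ^+ n).
Proof.
by move=> iidZ; congr series; apply/funext => n; rewrite (state_prob0 n iidZ).
Qed.

Lemma walk_matrixE (R : realType) (N : nat) (H : 'M[R]_N.+1) lambda v vbar
    (w : nat -> R)
    (d : measure_display) (T : measurableType d) (P : probability T R)
    (Z : nat -> {RV P >-> nat}) :
  spectral_data H lambda v vbar -> iid_with_law w Z -> 0 <= w 0%N < 1 ->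
  walk_matrix H Z 0 = walk_limit H (w 0%N).
Proof.
move=> spec iidZ w01; rewrite /walk_matrix (walk_seriesE H iidZ).
(* [limn] is a total operator; it is pinned down by actual convergence and uniqueness of limits. *)
apply: cvg_lim; first exact: norm_hausdorff.
exact: geometric_walk_cvg spec _ w01.
Qed.

Theorem mainTheorem14 (R : realType) :
  (forall (eps : R) (w : nat -> R)
      (d : measure_display) (T : measurableType d) (P : probability T R)
      (Z : nat -> {RV P >-> nat}),
    0 < eps <= 1 -> prob_distribution w -> w 0%N = 1 - eps ->
    iid_with_law w Z ->
    forall n : nat, state_prob Z n 0 = eps * (1 - eps) ^+ n)
  /\
  (forall (N : nat) (e : rel 'I_N.+1) (lambda : 'I_N.+1 -> R[i])
      (v : 'I_N.+1 -> 'cV[R[i]]_N.+1) (vbar : 'I_N.+1 -> 'rV[R[i]]_N.+1),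
    simple_graph e -> connected_graph e -> ~ bipartite e ->
    spectral_data (one_step R e) lambda v vbar ->
    (forall (eps : R) (w : nat -> R)
        (d : measure_display) (T : measurableType d) (P : probability T R)
        (Z : nat -> {RV P >-> nat}),
      0 < eps <= 1 -> prob_distribution w -> w 0%N = 1 - eps ->
      iid_with_law w Z ->
      [/\ cvgn (walk_series (one_step R e) Z 0),
          complexify (walk_matrix (one_step R e) Z 0) =
            ketbra (v ord0) (vbar ord0) +
            (1 - (w 0%N)%:C) *:
              \sum_(m | m != ord0)
                (1 - lambda m * (w 0%N)%:C)^-1 *: ketbra (v m) (vbar m) &
          eps = 1 -> walk_matrix (one_step R e) Z 0 = 1%:M])
    /\
    (forall (w : R -> nat -> R)
        (d : R -> measure_display) (T : forall eps : R, measurableType (d eps))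
        (P : forall eps : R, probability (T eps) R)
        (Z : forall eps : R, nat -> {RV (P eps) >-> nat}),
      (forall eps : R, 0 < eps <= 1 ->
        [/\ prob_distribution (w eps), w eps 0%N = 1 - eps &
            iid_with_law (w eps) (Z eps)]) ->
      complexify (walk_matrix (one_step R e) (Z eps) 0) @[eps --> 0^'+] -->
        ketbra (v ord0) (vbar ord0))).
Proof.
have oneB_itv (eps : R) : 0 < eps <= 1 -> 0 <= 1 - eps < 1.
  by move=> /andP[e0 e1]; rewrite subr_ge0 e1 gtrBl.
split=> [eps w d T P Z _ _ w0 iidZ n|N e lambda v vbar _ _ _ spec].
  by rewrite (state_prob0 n iidZ) w0 subKr.
split=> [eps w d T P Z eps01 _ w0 iidZ|w d T P Z model].
  have w01 : 0 <= w 0%N < 1 by rewrite w0 oneB_itv.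
  rewrite (walk_matrixE spec iidZ w01); split.
  - rewrite (walk_seriesE _ iidZ); apply/cvg_ex.
    by eexists; exact: geometric_walk_cvg spec _ w01.
  - exact: walk_limit_ketbra.
  (* For [eps = 1] the ratio [q] is 0 and the closed form reduces to the inverse of the identity. *)
  - by move=> eps1; rewrite w0 eps1 subrr /walk_limit scale0r !subr0 invr1 scale1r.
(* The model is specified only for [0 < eps <= 1], which holds eventually at [0^'+]; there the walk
   matrix equals [walk_limit (1 - eps)]. *)
apply: cvg_trans (walk_limit_cvg spec); apply: near_eq_cvg; near=> eps.
have eps01 : 0 < eps <= 1.
  by apply/andP; split=> //; near: eps; exact: nbhs_right_le.
have [_ w0 iidZ] := model eps eps01.
by rewrite (walk_matrixE spec iidZ) w0 ?oneB_itv.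
Unshelve. all: by end_near.
Qed.
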